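(* Let $(\mathbb{R}^n,g)$ be a pseudo-Euclidean space, $n\geq 3$, with coordinates $x=(x_1,\dots,x_n)$ and $g_{ij}=\delta_{ij}\varepsilon_i$, $\varepsilon_i\in\{1,-1\}$. Consider non-constant smooth functions $\varphi(\xi)$ and $f(\xi)$, with $f$ positive, where $\xi=\sum_{i=1}^n\alpha_ix_i$, $\alpha_i\in\mathbb{R}$, and $\sum_{i=1}^n\varepsilon_i\alpha_i^2=\varepsilon_{i_0}\in\{1,-1\}$. Then the warped product $M=(\mathbb{R}^n,\overline g)\times_f\mathbb{R}$, with $\overline g=\frac{1}{\varphi^2}g$, is a Ricci-flat manifold if, and only if, $$\varphi(\xi)=\left[\frac{2}{(-n+2)k_1\xi+k_2}\right]^{\frac{2}{n-2}},\qquad f(\xi)=\frac{2k}{(-n+2)k_1\xi+k_2},$$ where $k,k_1,k_2$ are constants with $k,k_1>0$. These solutions are defined on the half space determined by $\sum_{i=1}^n\alpha_ix_i<\frac{k_2}{(n-2)k_1}$.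
   Context: For semi-Riemannian manifolds $(B,g_B)$, $(F,g_F)$ and a smooth function $f>0$ on $B$, the warped product $B\times_fF$ is the product manifold $B\times F$ with the metric $g_B+f^2g_F$ (pullbacks by the projections being understood). Here the fiber is the one-dimensional manifold $\mathbb{R}$ with its standard metric. Ricci-flat means that the Ricci tensor vanishes identically. The base is written $(\mathbb{R}^n,\overline g)$, but it is understood to be the domain on which $\varphi$ and $f$ are defined (for the solutions above, the stated half space).
   Formalization: ''Only if'' fails for −φ and for reflected solutions (k1<0); formally φ is nonvanishing, and the literal iff is for φ>0 on R^n or a half space ξ<c (ξ-range an open interval unbounded below); on any open ξ-interval the iff holds up to φ→−φ and ξ→−ξ. *)

(* Defs.v *)
From HB Require Import structures.
From mathcomp Require Import all_boot all_order all_algebra.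
From mathcomp Require Import all_classical all_reals all_analysis.

Set Implicit Arguments.
Unset Strict Implicit.
Unset Printing Implicit Defensive.

Import Order.TTheory GRing.Theory Num.Theory.
Import numFieldNormedType.Exports.

Local Open Scope classical_set_scope.
Local Open Scope ring_scope.

Section Curvature.
Context {R : realType} {m : nat}.

(* A semi-Riemannian metric on an open subset of R^m is given by its matrix in
   the canonical coordinates, extended arbitrarily outside the open set: only
   germs of g at points of the set enter the definitions below. *)
Implicit Types (h : 'rV[R]_m -> R) (g : 'rV[R]_m -> 'M[R]_m) (x : 'rV[R]_m).

Definition partial (i : 'I_m) h x : R := 'D_(delta_mx 0 i) h x.

(* christoffel g k i j is Gamma^k_ij of the Levi-Civita connection. *)
Definition christoffel g (k i j : 'I_m) x : R :=
  2^-1 * \sum_l invmx (g x) k l *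
    (partial i (fun y => g y j l) x + partial j (fun y => g y i l) x
     - partial l (fun y => g y i j) x).

(* The component R^l_kij of R(X,Y)Z = D_X D_Y Z - D_Y D_X Z - D_[X,Y] Z:
   R(d_i, d_j) d_k = \sum_l R^l_kij d_l. *)
Definition riemann g (l k i j : 'I_m) x : R :=
  partial i (christoffel g l j k) x - partial j (christoffel g l i k) x
  + \sum_p (christoffel g l i p x * christoffel g p j k x
            - christoffel g l j p x * christoffel g p i k x).

(* Ric(Y,Z) is the trace of X |-> R(X,Y)Z. *)
Definition ricci g (j k : 'I_m) x : R := \sum_i riemann g i k i j x.

Definition ricci_flat (U : set 'rV[R]_m) g : Prop :=
  forall x, U x -> forall j k, ricci g j k x = 0.

End Curvature.

Section WarpedProduct.
Context {R : realType} {p q : nat}.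

(* Points of R^p x R^q are row vectors of length p + q. *)
Definition warped_metric (gB : 'rV[R]_p -> 'M[R]_p) (f : 'rV[R]_p -> R)
    (gF : 'rV[R]_q -> 'M[R]_q) (z : 'rV[R]_(p + q)) : 'M[R]_(p + q) :=
  block_mx (gB (lsubmx z)) 0 0 (f (lsubmx z) ^+ 2 *: gF (rsubmx z)).

Definition product_domain (U : set 'rV[R]_p) (V : set 'rV[R]_q) :
    set 'rV[R]_(p + q) :=
  [set z | U (lsubmx z) /\ V (rsubmx z)].

End WarpedProduct.

Section Ansatz.
Context {R : realType}.

Definition is_sign (x : R) : Prop := x = 1 \/ x = -1.

Definition pseudo_euclidean {n} (eps : 'I_n -> R) (_ : 'rV[R]_n) : 'M[R]_n :=
  diag_mx (\row_i eps i).

Definition conformal {n} (g : 'rV[R]_n -> 'M[R]_n) (phi : 'rV[R]_n -> R)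
    (x : 'rV[R]_n) : 'M[R]_n :=
  (phi x ^+ 2)^-1 *: g x.

Definition xi {n} (alpha : 'I_n -> R) (x : 'rV[R]_n) : R :=
  \sum_i alpha i * x 0 i.

(* (U, phi^-2 g) x_f R is Ricci-flat, where phi and f are functions of xi
   given on the interval I and U = {x | xi x \in I}. *)
Definition warped_ricci_flat {n} (eps alpha : 'I_n -> R) (I : set R)
    (phi f : R -> R) : Prop :=
  ricci_flat (product_domain [set x | I (xi alpha x)] [set: 'rV[R]_1])
    (warped_metric (conformal (pseudo_euclidean eps) (phi \o xi alpha))
                   (f \o xi alpha)
                   (fun=> 1%:M)).

(* For open I this is C^oo regularity on I. *)
Definition smooth_on (I : set R) (h : R -> R) : Prop :=
  forall (j : nat) (t : R), I t -> derivable (derive1n j h) t 1.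

Definition nonconstant_on (I : set R) (h : R -> R) : Prop :=
  exists s t, [/\ I s, I t & h s != h t].

Definition phi_sol (n : nat) (k1 k2 t : R) : R :=
  (2 / ((- n%:R + 2) * k1 * t + k2)) `^ (2 / (n%:R - 2)).

Definition f_sol (n : nat) (k k1 k2 t : R) : R :=
  2 * k / ((- n%:R + 2) * k1 * t + k2).

Definition half_line (n : nat) (k1 k2 : R) : set R :=
  [set t | t < k2 / ((n%:R - 2) * k1)].

End Ansatz.

(* Main.v *)
Require Import Defs.
From HB Require Import structures.
From mathcomp Require Import all_boot all_order all_algebra.
From mathcomp Require Import all_classical all_reals all_analysis.
From mathcomp Require Import ring lra.

Import Order.TTheory GRing.Theory Num.Theory.
Import numFieldNormedType.Exports.

Local Open Scope classical_set_scope.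
Local Open Scope ring_scope.

(** Write m = n - 2 and e = eps i0.

    The warped metric is diagonal and its coefficients depend on the point only
    through one linear form, xi, which ignores the fiber coordinate.  For such a
    metric the Christoffel symbols are again functions of xi, every partial
    derivative is a coefficient of xi times an ordinary derivative, and the
    Ricci tensor is an explicit expression in functions of one variable
    ([ricciE]).  Here it reads ([ricci_warped_base], [ricci_warped_mixed],
    [ricci_warped_fiber])

      Ric_ik = alpha_i alpha_k A + delta_ik eps_i e B  on the base,
      Ric = 0 on the mixed components, and
      Ric = e phi f C on the fiber,

    where A, B, C are the left-hand sides of [ricci_flat_odes].  The gradient of
    xi is not a null vector and n <> 1, so the base part vanishes only if A and
    B both do ([rank_one_plus_metric_eq0]).  As xi takes every real value, being
    Ricci-flat is the same as A = B = C = 0 on I ([warped_ricci_flat_odes]).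

    The system is solved with first integrals.  Equation C = 0 says that
    f' / phi^m is constant.  Eliminating f'' from A = 0 and C = 0 gives
    m phi'' f = n phi' f', which says that phi'^m / f^n is constant.  Neither
    constant is 0, because f and phi are not constant, so phi' has no zero.
    Now B = 0 becomes (n - 1) phi' (2 phi f' - m phi' f) = 0, hence
    2 f'/f = m phi'/phi and f^2 = K phi^m.  So f' is a constant times f^2 and
    1/f is an affine function of xi ([odes_solution]).  The sign sigma of the
    statement is the opposite of that of the slope of this affine function, and
    tau is the constant sign of phi.  Conversely the explicit functions have
    f'/f = m k1 / w and phi'/phi = 2 k1 / w with w = (2 - n) k1 xi + k2, up to
    the reflection sigma, and the three equations hold by substitution
    ([explicit_ricci_flat]). *)

(** * One-variable calculus in pointwise form *)

Section PointwiseDerivatives.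
Set Implicit Arguments.
Context {R : realType}.
Implicit Types (F G : R -> R) (x a b c : R).

Lemma is_derive1_mul F G x a b : is_derive x 1 F a -> is_derive x 1 G b ->
  is_derive x 1 (fun t => F t * G t) (a * G x + F x * b).
Proof.
move=> dF dG; apply: (@is_derive_eq _ _ _ (F * G)).
by rewrite /GRing.scale /=; ring.
Qed.

Lemma is_derive1_add F G x a b : is_derive x 1 F a -> is_derive x 1 G b ->
  is_derive x 1 (fun t => F t + G t) (a + b).
Proof. by move=> dF dG; apply: (@is_derive_eq _ _ _ (F + G)). Qed.

Lemma is_derive1_sub F G x a b : is_derive x 1 F a -> is_derive x 1 G b ->
  is_derive x 1 (fun t => F t - G t) (a - b).
Proof. by move=> dF dG; apply: (@is_derive_eq _ _ _ (F - G)). Qed.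

Lemma is_derive1_scale c F x a : is_derive x 1 F a ->
  is_derive x 1 (fun t => c * F t) (c * a).
Proof. by move=> dF; apply: (@is_derive_eq _ _ _ (c *: F)). Qed.

Lemma is_derive1_inv F x a : F x != 0 -> is_derive x 1 F a ->
  is_derive x 1 (fun t => (F t)^-1) (- a / F x ^+ 2).
Proof.
move=> Fx0 dF.
apply: (@is_derive_eq _ _ _ (fun t => (F t)^-1) _ _ _ _ (is_deriveV _ dF)) => //.
by rewrite /GRing.scale /= mulrC mulrN -mulNr.
Qed.

Lemma is_derive1_pow m F x a : is_derive x 1 F a ->
  is_derive x 1 (fun t => F t ^+ m) (m%:R * F x ^+ m.-1 * a).
Proof.
move=> dF; have -> : (fun t => F t ^+ m) = F ^+ m.
  by apply/funext => t; rewrite exprfctE.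
exact: (@is_derive_eq _ _ _ (F ^+ m)).
Qed.

Lemma is_derive1_affine a b x : is_derive x 1 (fun t : R => a * t + b) a.
Proof.
have h := is_derive1_add (is_derive1_scale a (is_derive_id x 1)) (is_derive_cst b x 1).
by apply: is_derive_eq h _; rewrite mulr1 addr0.
Qed.

Lemma is_derive1_chain F G x a b : is_derive (F x) 1 G b -> is_derive x 1 F a ->
  is_derive x 1 (fun t => G (F t)) (b * a).
Proof.
move=> dG dF; apply: (is_derive_eq (is_derive1_comp dG dF)).
by rewrite /GRing.scale /=.
Qed.

Lemma is_derive1_open (I : set R) F G x a : open I -> I x ->
  (forall t, I t -> F t = G t) -> is_derive x 1 G a -> is_derive x 1 F a.
Proof.
move=> oI Ix FG; apply: near_eq_is_derive.
by apply: filterS (open_nbhs_nbhs (conj oI Ix)) => t /FG.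
Qed.

End PointwiseDerivatives.

(** * Functions of a linear form *)

Section LinearForm.
Set Implicit Arguments.
Context {R : realType} {m : nat}.
Variable b : 'I_m -> R.

Lemma xi_line (v : 'rV[R]_m) x s : xi b (s *: v + x) = xi b v * s + xi b x.
Proof.
rewrite /xi mulr_suml -big_split /=; apply: eq_bigr => i _.
by rewrite !mxE; ring.
Qed.

Lemma xi_delta i : xi b (delta_mx 0 i) = b i.
Proof.
rewrite /xi (bigD1 i) //= big1 ?addr0 ?mxE ?eqxx ?mulr1 // => j ji.
by rewrite mxE (negbTE ji) andbF mulr0.
Qed.

Lemma xi_continuous : continuous (xi b).
Proof.
rewrite /xi; elim: (index_enum _) => [|i r IHr] x.
  have -> : (fun y : 'rV[R]_m => \sum_(j <- [::]) b j * y 0 j) = fun=> 0.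
    by apply/funext => y; rewrite big_nil.
  exact: cst_continuous.
have -> : (fun y : 'rV[R]_m => \sum_(j <- i :: r) b j * y 0 j) =
    fun y => b i * y 0 i + \sum_(j <- r) b j * y 0 j.
  by apply/funext => y; rewrite big_cons.
apply: cvgD (IHr x).
by apply: cvgM; [exact: cvg_cst|exact: coord_continuous].
Qed.

Lemma open_xi (I : set R) : open I -> open [set x | I (xi b x)].
Proof. by move=> oI; apply: open_comp => // x _; exact: xi_continuous. Qed.

(** Only the germ of [h] at [x] matters, so the identity is asked for on the
    slab where [xi b] is in [I]; this is all that is known of a metric defined
    on that slab. *)
Lemma partial_comp_xi (I : set R) (h : 'rV[R]_m -> R) (F : R -> R) i x d :
  open I -> I (xi b x) -> (forall y, I (xi b y) -> h y = F (xi b y)) ->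
  is_derive (xi b x) 1 F d -> partial i h x = b i * d.
Proof.
move=> oI Ix hF dF; rewrite /partial.
rewrite (@near_eq_derive _ _ _ _ (fun y => F (xi b y))); last first.
  by apply: filterS (open_nbhs_nbhs (conj (open_xi oI) Ix)) => y /hF.
have -> : 'D_(delta_mx 0 i) (fun y => F (xi b y)) x
    = 'D_1 (fun s => F (b i * s + xi b x)) (0 : R).
  rewrite /derive; set u := (fun _ : R => _); set v := (fun _ : R => _).
  suff -> : u = v by [].
  apply/funext => s; rewrite /u /v /= xi_line xi_delta addr0.
  by rewrite mulr0 add0r [s%:A]mulr1.
rewrite mulrC; apply: derive_val.
apply: is_derive1_chain; last exact: is_derive1_affine.
by rewrite mulr0 add0r.
Qed.

End LinearForm.

(** * Ricci tensor of a diagonal metric depending on a linear form *)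

Section DiagonalMetric.
Set Implicit Arguments.
Context {R : realType} {m : nat}.
Variables (b : 'I_m -> R) (I : set R) (H H1 H2 : 'I_m -> R -> R).
Variable g : 'rV[R]_m -> 'M[R]_m.
Hypothesis oI : open I.
Hypothesis dH : forall a t, I t -> is_derive t 1 (H a) (H1 a t).
Hypothesis dH1 : forall a t, I t -> is_derive t 1 (H1 a) (H2 a t).
Hypothesis H_neq0 : forall a t, I t -> H a t != 0.
Hypothesis gE : forall x, I (xi b x) -> g x = diag_mx (\row_a H a (xi b x)).

(** The quotient H_i' / H_k; on the diagonal it is the logarithmic derivative
    of a metric coefficient. *)
Definition slope k i t := H1 i t / H k t.

Definition slope' k i t := H2 i t / H k t - H1 i t * H1 k t / H k t ^+ 2.

(** The Christoffel symbols as functions of [t = xi b x].  They are linear in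
    the slopes, so that the same expression applied to [slope'] is the
    derivative in [t]: this is why [S] is a parameter. *)
Definition xi_christoffel (S : 'I_m -> 'I_m -> R -> R) (k i j : 'I_m) t : R :=
  2^-1 * ((j == k)%:R * b i * S k k t + (i == k)%:R * b j * S k k t
          - (i == j)%:R * b k * S k i t).

Lemma is_derive_slope k i t : I t -> is_derive t 1 (slope k i) (slope' k i t).
Proof.
move=> It; apply: is_derive_eq.
  apply: is_derive1_mul; first exact: dH1.
  by apply: is_derive1_inv; [exact: H_neq0|exact: dH].
by rewrite /slope'; ring.
Qed.

Lemma is_derive_xi_christoffel k i j t : I t ->
  is_derive t 1 (xi_christoffel slope k i j) (xi_christoffel slope' k i j t).
Proof.
move=> It; rewrite /xi_christoffel; apply: is_derive1_scale.
by apply: is_derive1_sub; [apply: is_derive1_add|];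
  apply: is_derive1_scale; exact: is_derive_slope.
Qed.

Lemma sum_delta (k : 'I_m) (F : 'I_m -> R) : \sum_i (i == k)%:R * F i = F k.
Proof.
rewrite (bigD1 k) //= eqxx mul1r big1 ?addr0 // => i /negbTE ->.
by rewrite mul0r.
Qed.

Lemma invmx_diag_metric x k l : I (xi b x) ->
  invmx (g x) k l = (l == k)%:R / H k (xi b x).
Proof.
move=> Ix; have gV : g x *m diag_mx (\row_a (H a (xi b x))^-1) = 1%:M.
  rewrite gE // mulmx_diag; apply/matrixP => a c; rewrite !mxE.
  by case: eqP => [->|]; rewrite ?mulr0n // mulfV ?H_neq0.
have [gu _] := mulmx1_unit gV.
rewrite -[invmx _]mulmx1 -gV mulmxA mulVmx // mul1mx !mxE eq_sym.
by have [->|_] := eqVneq k l; rewrite ?mul1r ?mulr1n ?mul0r ?mulr0n.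
Qed.

Lemma partial_diag_metric x a c i : I (xi b x) ->
  partial i (fun y => g y a c) x = (a == c)%:R * b i * H1 a (xi b x).
Proof.
move=> Ix; rewrite mulrAC mulrC.
apply: (partial_comp_xi _ (I := I) (F := fun t => (a == c)%:R * H a t)) => //.
  by move=> y /gE ->; rewrite !mxE mulr_natl; case: eqP => [->|].
exact/is_derive1_scale/dH.
Qed.

Lemma christoffelE k i j x : I (xi b x) ->
  christoffel g k i j x = xi_christoffel slope k i j (xi b x).
Proof.
move=> Ix; rewrite /christoffel /xi_christoffel; congr (_ * _).
under eq_bigr => l _ do
  rewrite invmx_diag_metric // !partial_diag_metric // -[_ / _ * _]mulrA.
rewrite sum_delta /slope; move: (xi b x) => t.
have [->|_] := eqVneq j k; have [->|_] := eqVneq i k; rewrite ?eqxx /=; ring.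
Qed.

Lemma riemannE l k i j x : I (xi b x) ->
  let t := xi b x in
  riemann g l k i j x =
    b i * xi_christoffel slope' l j k t - b j * xi_christoffel slope' l i k t
    + \sum_p (xi_christoffel slope l i p t * xi_christoffel slope p j k t
            - xi_christoffel slope l j p t * xi_christoffel slope p i k t).
Proof.
move=> Ix t; rewrite /riemann; congr (_ - _ + _).
- apply: (@partial_comp_xi R m b I _ (xi_christoffel slope l j k) i x _ oI Ix).
    by move=> y; exact: christoffelE.
  exact: is_derive_xi_christoffel.
- apply: (@partial_comp_xi R m b I _ (xi_christoffel slope l i k) j x _ oI Ix).
    by move=> y; exact: christoffelE.
  exact: is_derive_xi_christoffel.
- by apply: eq_bigr => p _; rewrite !christoffelE.
Qed.

(** The quadratic term of the Ricci tensor that is not a product of traces.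
    The hypothesis holds for [slope] because
    (H_p' / H_i) (H_i' / H_p) = (H_i' / H_i) (H_p' / H_p). *)
Lemma xi_christoffel_quadratic (S : 'I_m -> 'I_m -> R -> R) j k t :
  (forall i p, S i p t * S p i t = S i i t * S p p t) ->
  \sum_i \sum_p xi_christoffel S i j p t * xi_christoffel S p i k t =
  4^-1 * (b j * b k * (\sum_i S i i t ^+ 2 + 2 * S j j t * S k k t)
  - 2 * (j == k)%:R * S j j t * \sum_i b i ^+ 2 * S i j t).
Proof.
move=> SS.
have inner i : \sum_p xi_christoffel S i j p t * xi_christoffel S p i k t =
  4^-1 * (b j * b k * S i i t ^+ 2
   - (j == k)%:R * S j j t * (b i ^+ 2 * S i j t))
  + ((i == j)%:R * (4^-1 * (S i i t * (b k * b i * S k k t + b i * b k * S i i t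
       - (i == k)%:R * \sum_p b p ^+ 2 * S p i t) - b i * S i j t * b k * S j j t))
  + (i == k)%:R * (4^-1 * (b i * S i j t * b j * S j i t))).
  (* One group of terms for each Kronecker symbol that contains [p]. *)
  pose X p := 4^-1 * (b j * S i i t * ((k == p)%:R * b i * S p p t
    + (i == p)%:R * b k * S p p t - (k == i)%:R * b p * S p i t)).
  pose Y p := 4^-1 * (b i * S i j t * ((k == p)%:R * b i * S p p t
    + (i == p)%:R * b k * S p p t - (k == i)%:R * b p * S p i t)).
  pose Z p := 4^-1 * ((i == j)%:R * S i i t * b p * b i * S p p t).
  pose W p := 4^-1 * ((i == j)%:R * S i i t * b p * b k * S p p t).
  transitivity (\sum_p ((p == i)%:R * X p - (p == j)%:R * Y p
    + (p == k)%:R * Z p + (p == i)%:R * W p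
    - 4^-1 * (i == j)%:R * S i i t * (i == k)%:R * (b p ^+ 2 * S p i t))).
    apply: eq_bigr => p _; rewrite /xi_christoffel /X /Y /Z /W.
    rewrite ![p == _]eq_sym ![k == i]eq_sym ![j == i]eq_sym.
    by field.
  rewrite sumrB !big_split /= sumrN -mulr_sumr !sum_delta /X /Y /Z /W.
  rewrite ![k == _]eq_sym eqxx mulr1n.
  by field.
rewrite (eq_bigr _ (fun i _ => inner i)) !big_split /= !sum_delta.
rewrite -mulr_sumr sumrB -!mulr_sumr.
have -> : b k * S k j t * b j * S j k t = b j * b k * (S j j t * S k k t).
  by rewrite -SS; ring.
by field.
Qed.

Lemma xi_christoffel_trace (S : 'I_m -> 'I_m -> R -> R) i k t :
  xi_christoffel S i i k t = 2^-1 * b k * S i i t.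
Proof.
rewrite /xi_christoffel eqxx mulr1n.
by have [->|_] := eqVneq k i; rewrite ?eqxx; ring.
Qed.

Lemma xi_christoffel_divergence (S : 'I_m -> 'I_m -> R -> R) j k t :
  \sum_i b i * xi_christoffel S i j k t =
  2^-1 * (b j * b k * (S j j t + S k k t)
          - (j == k)%:R * \sum_i b i ^+ 2 * S i j t).
Proof.
transitivity (\sum_i ((i == k)%:R * (2^-1 * (b i * b j * S i i t))
  + (i == j)%:R * (2^-1 * (b i * b k * S i i t))
  - 2^-1 * (j == k)%:R * (b i ^+ 2 * S i j t))).
  apply: eq_bigr => i _; rewrite /xi_christoffel ![_ == i]eq_sym.
  by field.
by rewrite sumrB big_split /= -mulr_sumr !sum_delta; field.
Qed.

(** The contraction Gamma^i_ik is b_k / 2 times a logarithmic derivative and the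
    divergence of Gamma is explicit, so the Ricci tensor is the part proportional
    to b_j b_k, which involves only diagonal slopes, plus a diagonal part where
    the coefficients of the linear form enter through sums of
    b_i^2 H_j' / H_i. *)
Lemma ricciE j k x : I (xi b x) ->
  let t := xi b x in
  let L i := slope i i t in
  let L' i := slope' i i t in
  ricci g j k x =
    b j * b k * (2^-1 * (L' j + L' k - \sum_i L' i - L j * L k)
      + 4^-1 * ((\sum_i L i) * (L j + L k) - \sum_i L i ^+ 2))
    - (j == k)%:R * (2^-1 * \sum_i b i ^+ 2 * slope' i j t
      + (4^-1 * (\sum_i L i) - 2^-1 * L j) * \sum_i b i ^+ 2 * slope i j t).
Proof.
move=> Ix t L L'; rewrite /ricci.
transitivity (
    \sum_i b i * xi_christoffel slope' i j k t
    - b j * (2^-1 * b k * \sum_i L' i)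
    + (2^-1 * (\sum_i L i) * \sum_p b p * xi_christoffel slope p j k t
       - \sum_i \sum_p xi_christoffel slope i j p t
                       * xi_christoffel slope p i k t)).
  under eq_bigr => i _ do rewrite riemannE // xi_christoffel_trace [X in _ + X]sumrB.
  rewrite big_split /=; congr (_ + _); rewrite sumrB.
    by rewrite -!mulr_sumr.
  congr (_ - _); rewrite exchange_big /= mulr_sumr.
  apply: eq_bigr => p _; rewrite -mulr_suml.
  rewrite (eq_bigr _ (fun i _ => xi_christoffel_trace slope i p t)).
  by rewrite -mulr_sumr /L; ring.
rewrite !xi_christoffel_divergence xi_christoffel_quadratic; last first.
  by move=> i p; rewrite /slope; ring.
rewrite -/(L j) -/(L k) -/(L' j) -/(L' k).
rewrite -[\sum_i slope i i t]/(\sum_i L i) -[\sum_i slope i i t ^+ 2]/(\sum_i L i ^+ 2).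
by field.
Qed.

End DiagonalMetric.

(** * Ricci tensor of the warped product *)

Section WarpedRicci.
Set Implicit Arguments.
Context {R : realType} {n : nat}.
Variables (eps alpha : 'I_n -> R) (e : R).
Hypothesis eps_sign : forall i, is_sign (eps i).
Hypothesis alphaE : \sum_i eps i * alpha i ^+ 2 = e.
Variables (I : set R) (phi phi1 phi2 f f1 f2 : R -> R).
Hypothesis oI : open I.
Hypothesis dphi : forall t, I t -> is_derive t 1 phi (phi1 t).
Hypothesis dphi1 : forall t, I t -> is_derive t 1 phi1 (phi2 t).
Hypothesis df : forall t, I t -> is_derive t 1 f (f1 t).
Hypothesis df1 : forall t, I t -> is_derive t 1 f1 (f2 t).
Hypothesis phi_neq0 : forall t, I t -> phi t != 0.
Hypothesis f_neq0 : forall t, I t -> f t != 0.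

Definition on_base_fiber (c : 'I_n -> R) (d : R) (a : 'I_(n + 1)) : R :=
  row_mx (\row_i c i) (const_mx d) 0 a.

Lemma on_base c d i : on_base_fiber c d (lshift 1 i) = c i.
Proof. by rewrite /on_base_fiber row_mxEl mxE. Qed.

Lemma on_fiber c d i : on_base_fiber c d (rshift n i) = d.
Proof. by rewrite /on_base_fiber row_mxEr mxE. Qed.

(* The linear form [xi alpha], extended by 0 on the fiber. *)
Let b := on_base_fiber alpha 0.
Let H a t := on_base_fiber (fun i => eps i / phi t ^+ 2) (f t ^+ 2) a.
Let H1 a t :=
  on_base_fiber (fun i => - 2 * eps i * phi1 t / phi t ^+ 3) (2 * f t * f1 t) a.
Let H2 a t :=
  on_base_fiber (fun i => eps i * (6 * phi1 t ^+ 2 / phi t ^+ 4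
                                   - 2 * phi2 t / phi t ^+ 3))
                (2 * (f1 t ^+ 2 + f t * f2 t)) a.
Let g := warped_metric (conformal (pseudo_euclidean eps) (phi \o xi alpha))
                   (f \o xi alpha) (fun=> 1%:M : 'M[R]_1).

Lemma sign_sqr i : eps i ^+ 2 = 1.
Proof. by case: (eps_sign i) => ->; rewrite ?expr1n ?sqrrN ?expr1n. Qed.

Lemma sign_neq0 i : eps i != 0.
Proof. by rewrite -sqrf_eq0 sign_sqr oner_eq0. Qed.

Lemma sign_inv i : (eps i)^-1 = eps i.
Proof. by case: (eps_sign i) => ->; rewrite ?invrN invr1. Qed.

Lemma xi_on_base z : xi b z = xi alpha (lsubmx z).
Proof.
rewrite /xi big_split_ord /= [X in _ + X]big1 ?addr0; last first.
  by move=> i _; rewrite /b on_fiber mul0r.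
by apply: eq_bigr => i _; rewrite /b on_base mxE.
Qed.

Lemma is_derive_coef a t : I t -> is_derive t 1 (H a) (H1 a t).
Proof.
move=> It; have p0 := phi_neq0 It.
rewrite /H /H1; case: (split_ordP a) => i ->.
  rewrite on_base; under eq_fun do rewrite on_base.
  apply: is_derive_eq.
    apply/is_derive1_scale/is_derive1_inv; first by rewrite expf_neq0.
    exact/is_derive1_pow/dphi.
  by rewrite /=; field.
rewrite on_fiber; under eq_fun do rewrite on_fiber.
by apply: is_derive_eq; [exact/is_derive1_pow/df|rewrite /=; ring].
Qed.

Lemma is_derive_coef1 a t : I t -> is_derive t 1 (H1 a) (H2 a t).
Proof.
move=> It; have p0 := phi_neq0 It.
rewrite /H1 /H2; case: (split_ordP a) => i ->.
  rewrite on_base; under eq_fun do rewrite on_base.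
  apply: is_derive_eq.
    apply: is_derive1_mul; first exact/is_derive1_scale/dphi1.
    by apply/is_derive1_inv; [rewrite expf_neq0|exact/is_derive1_pow/dphi].
  by rewrite /=; field.
rewrite on_fiber; under eq_fun do rewrite on_fiber.
apply: is_derive_eq.
  apply: is_derive1_mul; last exact: df1.
  exact/is_derive1_scale/df.
by rewrite /=; ring.
Qed.

Lemma coef_neq0 a t : I t -> H a t != 0.
Proof.
move=> It; rewrite /H; case: (split_ordP a) => i ->.
  by rewrite on_base mulf_neq0 ?sign_neq0 ?invr_eq0 ?expf_neq0 ?phi_neq0.
by rewrite on_fiber expf_neq0 ?f_neq0.
Qed.

Lemma warped_metric_diag x : I (xi b x) ->
  g x = diag_mx (\row_a H a (xi b x)).
Proof.
move=> _; rewrite /g /warped_metric xi_on_base.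
have -> : \row_a H a (xi alpha (lsubmx x)) =
    row_mx (\row_i (eps i / phi (xi alpha (lsubmx x)) ^+ 2))
           (const_mx (f (xi alpha (lsubmx x)) ^+ 2)).
  by apply/rowP => a; rewrite mxE.
rewrite diag_mx_row; congr block_mx; apply/matrixP => i k; rewrite !mxE.
  by rewrite mulrnAr mulrC.
by rewrite !ord1 /= !mulr1n mulr1.
Qed.

Let S := slope H H1.
Let S' := slope' H H1 H2.

Lemma slope_base i t : I t -> S (lshift 1 i) (lshift 1 i) t = - 2 * (phi1 t / phi t).
Proof.
move=> It; rewrite /S /slope /H /H1 !on_base.
by field; rewrite phi_neq0 ?sign_neq0.
Qed.

Lemma slope_fiber t : I t -> S (rshift n 0) (rshift n 0) t = 2 * (f1 t / f t).
Proof.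
move=> It; rewrite /S /slope /H /H1 !on_fiber.
by field; rewrite f_neq0.
Qed.

Lemma slope'_base i t : I t -> S' (lshift 1 i) (lshift 1 i) t =
  - 2 * (phi2 t / phi t - (phi1 t / phi t) ^+ 2).
Proof.
move=> It; rewrite /S' /slope' /H /H1 /H2 !on_base.
by field; rewrite phi_neq0 ?sign_neq0.
Qed.

Lemma slope'_fiber t : I t -> S' (rshift n 0) (rshift n 0) t =
  2 * (f2 t / f t - (f1 t / f t) ^+ 2).
Proof.
move=> It; rewrite /S' /slope' /H /H1 /H2 !on_fiber.
by field; rewrite f_neq0.
Qed.

Lemma sum_constant_on_base (F : 'I_(n + 1) -> R) c : (forall i, F (lshift 1 i) = c) ->
  \sum_a F a = n%:R * c + F (rshift n 0).
Proof.
move=> Fc; rewrite big_split_ord big_ord1 (eq_bigr (fun=> c)) //=.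
by rewrite sumr_const card_ord mulr_natl.
Qed.

(** The sums of [ricciE] weighted by squared coefficients of the linear form
    are the squared norm of the gradient of xi, up to a factor. *)
Lemma sum_sqr_gradient (F : 'I_(n + 1) -> R) c :
  (forall i, F (lshift 1 i) = eps i * c) ->
  \sum_a b a ^+ 2 * F a = e * c.
Proof.
move=> Fc; rewrite big_split_ord big_ord1 /= /b on_fiber expr0n mul0r addr0.
rewrite -alphaE mulr_suml; apply: eq_bigr => i _.
by rewrite on_base Fc mulrA [eps i * _]mulrC.
Qed.

(** The coefficient of alpha_i alpha_k collects the Hessians of phi and f, and
    the other one collects the Laplacian and gradient terms of the conformal
    change together with the gradient term in the Hessian of f. *)
Lemma ricci_warped_base i k x : I (xi alpha (lsubmx x)) ->
  let t := xi alpha (lsubmx x) in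
  ricci g (lshift 1 i) (lshift 1 k) x =
    alpha i * alpha k * ((n%:R - 2) * (phi2 t / phi t) - f2 t / f t
                         - 2 * (phi1 t / phi t) * (f1 t / f t))
    + (i == k)%:R * eps i * e * (phi2 t / phi t
        - (n%:R - 1) * (phi1 t / phi t) ^+ 2 + (phi1 t / phi t) * (f1 t / f t)).
Proof.
rewrite -xi_on_base => Ix t.
rewrite (@ricciE _ _ b I H H1 H2 g oI is_derive_coef is_derive_coef1 coef_neq0
  warped_metric_diag) //.
rewrite -/S -/S' -/t.
rewrite (@sum_constant_on_base _ (- 2 * (phi2 t / phi t - (phi1 t / phi t) ^+ 2)));
  last first.
  by move=> a; rewrite slope'_base.
rewrite (@sum_constant_on_base _ (- 2 * (phi1 t / phi t)));
  last by move=> a; rewrite slope_base.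
rewrite (@sum_constant_on_base _ ((- 2 * (phi1 t / phi t)) ^+ 2)); last first.
  by move=> a; rewrite slope_base.
rewrite !slope'_base // !slope_base // slope_fiber // slope'_fiber //.
rewrite (@sum_sqr_gradient _
  (- 2 * eps i * (phi2 t / phi t - (phi1 t / phi t) ^+ 2))); last first.
  move=> a; rewrite /S' /slope' /H /H1 /H2 !on_base.
  (* With the inverse of [eps a] this is an identity of rational functions. *)
  rewrite -[X in _ = X * _]sign_inv.
  by field; rewrite phi_neq0 ?sign_neq0.
rewrite (@sum_sqr_gradient _ (- 2 * eps i * (phi1 t / phi t))); last first.
  move=> a; rewrite /S /slope /H /H1 !on_base.
  rewrite -[X in _ = X * _]sign_inv.
  by field; rewrite phi_neq0 ?sign_neq0.
have -> : (lshift 1 i == lshift 1 k) = (i == k) by [].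
rewrite /b !on_base; move: (phi1 t / phi t) (phi2 t / phi t) => u u'.
by field; rewrite ?f_neq0.
Qed.

Lemma ricci_warped_mixed i x : I (xi alpha (lsubmx x)) ->
  ricci g (lshift 1 i) (rshift n 0) x = 0 /\
  ricci g (rshift n 0) (lshift 1 i) x = 0.
Proof.
rewrite -xi_on_base => Ix.
rewrite !(@ricciE _ _ b I H H1 H2 g oI is_derive_coef is_derive_coef1 coef_neq0
  warped_metric_diag) //.
by rewrite eq_lrshift eq_rlshift /b !on_fiber mulr0 !mul0r subr0.
Qed.

Lemma ricci_warped_fiber x : I (xi alpha (lsubmx x)) ->
  let t := xi alpha (lsubmx x) in
  ricci g (rshift n 0) (rshift n 0) x =
    e * phi t * f t * ((n%:R - 2) * phi1 t * f1 t - phi t * f2 t).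
Proof.
rewrite -xi_on_base => Ix t.
rewrite (@ricciE _ _ b I H H1 H2 g oI is_derive_coef is_derive_coef1 coef_neq0
  warped_metric_diag) //.
rewrite -/S -/S' -/t.
rewrite [\sum_i S i i t](@sum_constant_on_base _ (- 2 * (phi1 t / phi t)));
  last by move=> a; rewrite slope_base.
rewrite slope_fiber //.
rewrite (@sum_sqr_gradient _ (2 * phi t ^+ 2 * (f1 t ^+ 2 + f t * f2 t)
  + 4 * f t * f1 t * phi t * phi1 t)); last first.
  move=> a; rewrite /S' /slope' /H /H1 /H2 !on_base !on_fiber.
  rewrite -[X in _ = X * _]sign_inv.
  by field; rewrite phi_neq0 ?sign_neq0.
rewrite (@sum_sqr_gradient _ (2 * phi t ^+ 2 * f t * f1 t)); last first.
  move=> a; rewrite /S /slope /H /H1 !on_base !on_fiber.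
  rewrite -[X in _ = X * _]sign_inv.
  by field; rewrite phi_neq0 ?sign_neq0.
rewrite /b !on_fiber eqxx mulr1n.
by field; rewrite ?phi_neq0 ?f_neq0.
Qed.

Definition ricci_flat_odes t : Prop :=
  [/\ (n%:R - 2) * (phi2 t / phi t) - f2 t / f t
        - 2 * (phi1 t / phi t) * (f1 t / f t) = 0,
      phi2 t / phi t - (n%:R - 1) * (phi1 t / phi t) ^+ 2
        + (phi1 t / phi t) * (f1 t / f t) = 0
    & (n%:R - 2) * phi1 t * f1 t - phi t * f2 t = 0].

Hypothesis e_neq0 : e != 0.

(** A suitable multiple of the gradient of xi is a preimage. *)
Lemma xi_surjective t : exists x : 'rV[R]_n, xi alpha x = t.
Proof.
exists (\row_i (t / e * (eps i * alpha i))).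
rewrite /xi; under eq_bigr => i _ do rewrite mxE mulrCA.
rewrite -mulr_sumr -[RHS](divfK e_neq0) -alphaE; congr (_ * _).
by apply: eq_bigr => i _; ring.
Qed.

(** Contracting with the inverse metric gives e (A + n B) = 0, and contracting
    with the gradient of xi twice gives e^2 (A + B) = 0; these two equations are
    independent as soon as n <> 1. *)
Lemma rank_one_plus_metric_eq0 (A B : R) : n != 1 ->
  (forall i k, alpha i * alpha k * A + (i == k)%:R * eps i * e * B = 0) ->
  A = 0 /\ B = 0.
Proof.
move=> n1 AB.
have trace : e * A + n%:R * (e * B) = 0.
  transitivity (\sum_i eps i *
      (alpha i * alpha i * A + (i == i)%:R * eps i * e * B)); last first.
    by rewrite big1 // => i _; rewrite AB mulr0.
  rewrite (eq_bigr (fun i => eps i * alpha i ^+ 2 * A + e * B)) => [|i _].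
    by rewrite big_split /= -mulr_suml alphaE sumr_const card_ord mulr_natl.
  transitivity (eps i * alpha i ^+ 2 * A + eps i ^+ 2 * (e * B)).
    by rewrite eqxx mulr1n; ring.
  by rewrite sign_sqr mul1r.
have normal i : alpha i * (e * (A + B)) = 0.
  transitivity (\sum_k eps k * alpha k *
      (alpha i * alpha k * A + (i == k)%:R * eps i * e * B)); last first.
    by rewrite big1 // => k _; rewrite AB mulr0.
  rewrite (eq_bigr (fun k => eps k * alpha k ^+ 2 * (alpha i * A)
      + (k == i)%:R * (alpha k * (eps k * eps i * (e * B))))) => [|k _].
    rewrite big_split /= -mulr_suml alphaE sum_delta -expr2 sign_sqr.
    by ring.
  by rewrite [k == i]eq_sym; ring.
have AB0 : A + B = 0.
  apply: (mulfI e_neq0); apply: (mulfI e_neq0); rewrite !mulr0.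
  rewrite -{1}alphaE mulr_suml big1 // => i _.
  by rewrite expr2 -!mulrA normal !mulr0.
have BE : A = - B by apply/eqP; rewrite -addr_eq0 AB0.
have : (n%:R - 1) * (e * B) = 0.
  by rewrite -trace BE; ring.
move/eqP; rewrite !mulf_eq0 (negbTE e_neq0) subr_eq0 pnatr_eq1 (negbTE n1) /=.
by move/eqP => B0; rewrite BE B0 oppr0.
Qed.

Lemma warped_ricci_flat_odes : n != 1 ->
  warped_ricci_flat eps alpha I phi f <-> (forall t, I t -> ricci_flat_odes t).
Proof.
move=> n1; split=> [flat t It|ode z [Iz _] j k]; last first.
  have [A B C] := ode _ Iz.
  case: (split_ordP j) => i ->; case: (split_ordP k) => l ->.
  - by rewrite ricci_warped_base // A B !mulr0 addr0.
  - by rewrite ord1; case: (ricci_warped_mixed i Iz).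
  - by rewrite ord1; case: (ricci_warped_mixed l Iz).
  - by rewrite !ord1 ricci_warped_fiber // C mulr0.
have [x xt] := xi_surjective t.
pose z := row_mx x (0 : 'rV[R]_1).
have zt : xi alpha (lsubmx z) = t by rewrite row_mxKl.
have Iz : I (xi alpha (lsubmx z)) by rewrite zt.
have Ric0 j k : ricci g j k z = 0 by apply: flat; split.
have [A B] := @rank_one_plus_metric_eq0 _ _ n1 (fun i k =>
  etrans (esym (ricci_warped_base i k Iz)) (Ric0 (lshift 1 i) (lshift 1 k))).
rewrite zt in A B; split => //.
have /eqP := Ric0 (rshift n 0) (rshift n 0).
rewrite ricci_warped_fiber // zt !mulf_eq0 (negbTE e_neq0).
by rewrite (negbTE (phi_neq0 It)) (negbTE (f_neq0 It)) => /eqP.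
Qed.

End WarpedRicci.

(** * The differential system *)

Section ODE.
Set Implicit Arguments.
Context {R : realType}.
Implicit Types (I : set R) (h : R -> R).

Lemma derivable_interval_continuous I h (dh : R -> R) a b : is_interval I ->
  (forall t, I t -> is_derive t 1 h (dh t)) -> I a -> I b ->
  {within `[a, b], continuous h}.
Proof.
move=> itvI hI Ia Ib; apply: derivable_within_continuous => t.
by rewrite in_itv /= => tab; have [] := hI _ (itvI _ _ Ia Ib _ tab).
Qed.

Lemma derive0_constant I h (s t : R) : is_interval I ->
  (forall u, I u -> is_derive u 1 h 0) -> I s -> I t -> h s = h t.
Proof.
move=> itvI dh0.
wlog st : s t / s <= t => [hwlog Is It|Is It].
  by have [/hwlog|/ltW/hwlog] := leP s t => ->.
have hc := @derivable_interval_continuous I h (fun=> 0) s t itvI dh0 Is It.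
have dst c : c \in `]s, t[%R -> is_derive c 1 h 0.
  rewrite in_itv /= => /andP[sc ct]; apply/dh0/(itvI s t) => //.
  by rewrite !ltW.
have [c _] := @MVT_segment _ h (fun=> 0) s t st dst hc.
by rewrite mul0r => /eqP; rewrite subr_eq0 => /eqP.
Qed.

Lemma nonconstant_derive_neq0 I h (dh : R -> R) : is_interval I ->
  (forall t, I t -> is_derive t 1 h (dh t)) -> nonconstant_on I h ->
  ~ (forall t, I t -> dh t = 0).
Proof.
move=> itvI dhI [s [t [Is It /eqP hst]]] dh0; apply: hst.
by apply: derive0_constant itvI _ Is It => u Iu; rewrite -(dh0 u Iu); exact: dhI.
Qed.

Lemma neq0_constant_sign I h (dh : R -> R) : is_interval I ->
  (forall t, I t -> is_derive t 1 h (dh t)) -> (forall t, I t -> h t != 0) ->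
  exists tau, is_sign tau /\ forall t, I t -> 0 < tau * h t.
Proof.
move=> itvI dhI h0.
have same s t : I s -> I t -> 0 < h s -> 0 < h t.
  move=> Is It hs; rewrite lt_neqAle eq_sym h0 //= leNgt; apply/negP => ht.
  have [st|/ltW ts] := leP s t.
    have [||c] := @IVT _ h s t 0 st.
    - exact: (@derivable_interval_continuous I h dh).
    - by rewrite ge_min le_max (ltW ht) (ltW hs) orbT.
    by rewrite in_itv /= => /(itvI _ _ Is It) /h0 /eqP.
  have [||c] := @IVT _ h t s 0 ts.
  - exact: (@derivable_interval_continuous I h dh).
  - by rewrite ge_min le_max (ltW ht) (ltW hs) orbT.
  by rewrite in_itv /= => /(itvI _ _ It Is) /h0 /eqP.
have [[s [Is hs]]|none] := pselect (exists s, I s /\ 0 < h s).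
  exists 1; split; first by left.
  by move=> t It; rewrite mul1r; exact: same hs.
exists (-1); split; first by right.
move=> t It; rewrite mulN1r oppr_gt0 lt_neqAle h0 //= leNgt.
by apply/negP => ht; apply: none; exists t.
Qed.

Variables (m : nat) (I : set R) (phi phi1 phi2 f f1 f2 : R -> R).
Hypothesis m_gt0 : (0 < m)%N.
Hypothesis itvI : is_interval I.
Hypothesis dphi : forall t, I t -> is_derive t 1 phi (phi1 t).
Hypothesis dphi1 : forall t, I t -> is_derive t 1 phi1 (phi2 t).
Hypothesis df : forall t, I t -> is_derive t 1 f (f1 t).
Hypothesis df1 : forall t, I t -> is_derive t 1 f1 (f2 t).
Hypothesis phi_gt0 : forall t, I t -> 0 < phi t.
Hypothesis f_gt0 : forall t, I t -> 0 < f t.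
Hypothesis phi_nonconstant : nonconstant_on I phi.
Hypothesis f_nonconstant : nonconstant_on I f.
Hypothesis odes : forall t, I t ->
  ricci_flat_odes (n := m.+2) phi phi1 phi2 f f1 f2 t.

Let phi_neq0 t : I t -> phi t != 0. Proof. by move/phi_gt0/lt0r_neq0. Qed.
Let f_neq0 t : I t -> f t != 0. Proof. by move/f_gt0/lt0r_neq0. Qed.
Let m_neq0 : m%:R != 0 :> R. Proof. by rewrite pnatr_eq0 -lt0n. Qed.
Let m2 : m.+2%:R - 2 = m%:R :> R. Proof. by rewrite -addn2 natrD addrK. Qed.

(** Harmonicity of f on the base, phi f'' = m phi' f', says that f' / phi^m has
    zero derivative. *)
Lemma fiber_first_integral : exists2 C, C != 0 & forall t, I t -> f1 t = C * phi t ^+ m.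
Proof.
have [s0 [_ [Is0 _ _]]] := f_nonconstant.
pose C := f1 s0 / phi s0 ^+ m.
have f1E t : I t -> f1 t = C * phi t ^+ m.
  move=> It; rewrite -[LHS](divfK (expf_neq0 m (phi_neq0 It))); congr (_ * _).
  apply: (@derive0_constant I (fun u => f1 u / phi u ^+ m)) => // u Iu.
  apply: is_derive_eq.
    apply: is_derive1_mul; first exact: df1.
    by apply: is_derive1_inv; [rewrite expf_neq0 ?phi_neq0|exact/is_derive1_pow/dphi].
  have p0 := phi_neq0 Iu; have [_ _] := odes Iu; rewrite m2.
  case: m m_gt0 => // m' _ /= /(canRL (subrK _)); rewrite add0r => E.
  have -> : f2 u = m'.+1%:R * phi1 u * f1 u / phi u by rewrite E mulrAC divff ?mul1r.
  by rewrite !exprS; field; rewrite p0 expf_neq0.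
exists C => //; apply/eqP => C0.
have := @nonconstant_derive_neq0 I f f1 itvI df f_nonconstant; apply=> t It.
by rewrite f1E // C0 mul0r.
Qed.

(** The first equation once f'' is replaced by its value from the third. *)
Lemma phi2_eliminated t : I t ->
  m%:R * phi2 t * f t = m.+2%:R * phi1 t * f1 t.
Proof.
move=> It; have p0 := phi_neq0 It; have q0 := f_neq0 It.
have [A _ C] := odes It; rewrite m2 in A C.
have {C}C : m%:R * phi1 t * f1 t = phi t * f2 t by apply/eqP; rewrite -subr_eq0 C.
apply/eqP; rewrite -subr_eq0 -[m.+2]addn2 natrD !mulrDl C.
apply/eqP; transitivity (phi t * f t * 0); last by rewrite mulr0.
by rewrite -A; field; rewrite p0 q0.
Qed.

(** By [phi2_eliminated], phi'^m / f^(m+2) has zero derivative.  If phi' had a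
    zero then this constant would be 0, and phi would be constant. *)
Lemma phi1_neq0 t : I t -> phi1 t != 0.
Proof.
move=> It; apply/eqP => phi1t0.
have := @nonconstant_derive_neq0 I phi phi1 itvI dphi phi_nonconstant; apply=> s Is.
have : phi1 s ^+ m / f s ^+ m.+2 = 0.
  transitivity (phi1 t ^+ m / f t ^+ m.+2); last first.
    by rewrite phi1t0 expr0n eqn0Ngt m_gt0 mul0r.
  apply: (@derive0_constant I (fun u => phi1 u ^+ m / f u ^+ m.+2)) => // u Iu.
  apply: is_derive_eq.
    apply: is_derive1_mul; first exact/is_derive1_pow/dphi1.
    by apply: is_derive1_inv; [rewrite expf_neq0 ?f_neq0|exact/is_derive1_pow/df].
  have p0 := phi_neq0 Iu; have q0 := f_neq0 Iu.
  have E := phi2_eliminated Iu.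
  case: m m_gt0 E => // m' _ E /=.
  have -> : phi2 u = m'.+3%:R * phi1 u * f1 u / (m'.+1%:R * f u).
    by rewrite -E; field; rewrite q0 ?nat1r ?natr1 ?pnatr_eq0.
  by rewrite !exprS; field; rewrite q0 expf_neq0 ?nat1r ?natr1 ?pnatr_eq0.
move/eqP; rewrite mulf_eq0 invr_eq0 !expf_eq0 (negbTE (f_neq0 Is)) andbF orbF.
by rewrite m_gt0 => /eqP.
Qed.

(** Substituting [phi2_eliminated] in the second equation leaves the product of
    (m + 1) phi' and the difference of the two sides. *)
Lemma log_derivatives_proportional t : I t ->
  2 * phi t * f1 t = m%:R * phi1 t * f t.
Proof.
move=> It; have p0 := phi_neq0 It; have q0 := f_neq0 It.
have [A B C] := odes It; rewrite m2 in A C.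
have p10 := phi1_neq0 It.
have M := phi2_eliminated It.
have n1 : m.+1%:R != 0 :> R by rewrite pnatr_eq0.
apply: (mulfI p10); apply: (mulfI n1).
apply/eqP; rewrite -subr_eq0; apply/eqP.
transitivity (m%:R * phi t ^+ 2 * f t * 0); last by rewrite mulr0.
rewrite -B; have -> : phi2 t = m.+2%:R * phi1 t * f1 t / (m%:R * f t).
  by rewrite -M; field; rewrite q0.
rewrite -[m.+2]addn2 -[m.+1]addn1 !natrD; field.
by rewrite p0 q0.
Qed.

(** This is [log_derivatives_proportional] integrated. *)
Lemma base_power_of_fiber : exists2 K, 0 < K & forall t, I t -> f t ^+ 2 = K * phi t ^+ m.
Proof.
have [s0 [_ [Is0 _ _]]] := f_nonconstant.
exists (f s0 ^+ 2 / phi s0 ^+ m).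
  by rewrite divr_gt0 ?exprn_gt0 ?f_gt0 ?phi_gt0.
move=> t It; rewrite -[LHS](divfK (expf_neq0 m (phi_neq0 It))); congr (_ * _).
apply: (@derive0_constant I (fun u => f u ^+ 2 / phi u ^+ m)) => // u Iu.
apply: is_derive_eq.
  apply: is_derive1_mul; first exact/is_derive1_pow/df.
  by apply: is_derive1_inv; [rewrite expf_neq0 ?phi_neq0|exact/is_derive1_pow/dphi].
have p0 := phi_neq0 Iu; have := log_derivatives_proportional Iu.
case: m m_gt0 => // m' _ /= E.
have -> : f1 u = m'.+1%:R * phi1 u * f u / (2 * phi u).
  by rewrite -E; field.
by rewrite !exprS; field; rewrite p0 expf_neq0.
Qed.

(** With f' = C phi^m and f^2 = K phi^m the derivative of 1/f is - C / K, so
    1/f = E - (C / K) t.  Dividing f by k = sqrt K turns the second relation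
    into phi = (f / k)^(2 / m), and the factor 2 k in [c] and [d] makes f / k
    equal to 2 / (c - d t). *)
Lemma odes_solution : exists k d c, [/\ 0 < k, d != 0 &
  forall t, I t -> [/\ 0 < c - d * t, f t = k * (2 / (c - d * t)) &
                      phi t = (2 / (c - d * t)) `^ (2 / m%:R)]].
Proof.
have [C C0 f1E] := fiber_first_integral.
have [K K0 fphi] := base_power_of_fiber.
have [s0 [_ [Is0 _ _]]] := f_nonconstant.
pose k := Num.sqrt K.
have k0 : 0 < k by rewrite sqrtr_gt0.
have k2 : k ^+ 2 = K by rewrite sqr_sqrtr // ltW.
have kn0 := lt0r_neq0 k0.
have inv_affine t : I t -> (f t)^-1 + C / K * t = (f s0)^-1 + C / K * s0.
  move=> It; apply: (@derive0_constant I (fun u => (f u)^-1 + C / K * u)) => // u Iu.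
  apply: is_derive_eq.
    exact: (is_derive1_add (is_derive1_inv (f_neq0 Iu) (df Iu))
                           (is_derive1_scale (C / K) (is_derive_id u 1))).
  rewrite fphi // f1E //; field.
  by rewrite (lt0r_neq0 K0) expf_neq0 ?phi_neq0.
set E := (f s0)^-1 + _ in inv_affine.
exists k, (2 * k * (C / K)), (2 * k * E); split => //.
  by rewrite !mulf_neq0 ?invr_eq0 ?(lt0r_neq0 K0).
move=> t It; have q0 := f_neq0 It; have q1 := f_gt0 It.
have -> : 2 * k * E - 2 * k * (C / K) * t = 2 * k / f t.
  by rewrite -(inv_affine _ It); ring.
have -> : 2 / (2 * k / f t) = f t / k by field; rewrite kn0.
split; first by rewrite divr_gt0 ?mulr_gt0.
  by field.
rewrite powRrM powR_mulrn ?divr_ge0 ?(ltW k0) ?(ltW q1) //.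
rewrite expr_div_n k2 fphi // mulrAC divff ?(lt0r_neq0 K0) // mul1r.
rewrite -powR_mulrn ?(ltW (phi_gt0 It)) // -powRrM divff // powRr1 //.
exact/ltW/phi_gt0.
Qed.

End ODE.

(** * The explicit solutions *)

Section ExplicitSolutions.
Set Implicit Arguments.
Context {R : realType} (m : nat).
Hypothesis m_gt0 : (0 < m)%N.
Variables (k k1 k2 : R).
Hypothesis k_gt0 : 0 < k.
Hypothesis k1_gt0 : 0 < k1.

Let n := m.+2.
Let m_neq0 : m%:R != 0 :> R. Proof. by rewrite pnatr_eq0 -lt0n. Qed.
Let mR_gt0 : 0 < m%:R :> R. Proof. by rewrite ltr0n. Qed.
Let nE : n%:R = m%:R + 2 :> R. Proof. by rewrite /n -addn2 natrD. Qed.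

Definition denominator (j : nat) (a b t : R) : R := (- j%:R + 2) * a * t + b.

Let w := denominator n k1 k2.

Lemma half_lineP t : half_line n k1 k2 t <-> 0 < w t.
Proof.
rewrite /half_line /= nE addrK ltr_pdivlMr ?mulr_gt0 //.
rewrite /w /denominator nE; split => H; lra.
Qed.

Lemma is_derive_denominator (t : R) : is_derive t 1 w (- m%:R * k1).
Proof.
have -> : - m%:R * k1 = (- n%:R + 2) * k1 by rewrite nE; ring.
exact: (is_derive1_affine ((- n%:R + 2) * k1) k2 t).
Qed.

Lemma is_derive_phi_sol (t : R) : 0 < w t ->
  is_derive t 1 (phi_sol n k1 k2) (2 * k1 / w t * phi_sol n k1 k2 t).
Proof.
move=> wt; have w0 := lt0r_neq0 wt.
have q0 : 0 < 2 / w t by rewrite divr_gt0.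
have d2w : is_derive t 1 (fun s => 2 / w s) (2 * (m%:R * k1 / w t ^+ 2)).
  apply: (is_derive_eq
    (is_derive1_scale 2 (is_derive1_inv w0 (is_derive_denominator t)))).
  by rewrite mulNr opprK.
have := @is_derive1_chain _ (fun s => 2 / w s) _ _ _ _
  (is_derive1_powR (2 / (n%:R - 2)) q0) d2w.
move/is_derive_eq; apply.
have p0 : 0 < 2 / (n%:R - 2) :> R by rewrite nE addrK divr_gt0.
rewrite /phi_sol -/(denominator n k1 k2 t) -/w -(mulr_powRB1 (ltW q0) p0) nE addrK.
by field; rewrite w0.
Qed.

Lemma is_derive_phi_sol' (t : R) : 0 < w t ->
  is_derive t 1 (fun s => 2 * k1 / w s * phi_sol n k1 k2 s)
                (2 * (m%:R + 2) * k1 ^+ 2 / w t ^+ 2 * phi_sol n k1 k2 t).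
Proof.
move=> wt; have w0 := lt0r_neq0 wt.
apply: (is_derive_eq (is_derive1_mul
  (is_derive1_scale (2 * k1) (is_derive1_inv w0 (is_derive_denominator t)))
  (is_derive_phi_sol t wt))).
by rewrite /=; field.
Qed.

Lemma is_derive_f_sol (t : R) : 0 < w t ->
  is_derive t 1 (f_sol n k k1 k2) (2 * k * m%:R * k1 / w t ^+ 2).
Proof.
move=> wt; have w0 := lt0r_neq0 wt.
apply: (is_derive_eq
  (is_derive1_scale (2 * k) (is_derive1_inv w0 (is_derive_denominator t)))).
by rewrite /=; field.
Qed.

Lemma is_derive_f_sol' (t : R) : 0 < w t ->
  is_derive t 1 (fun s => 2 * k * m%:R * k1 / w s ^+ 2)
                (4 * k * m%:R ^+ 2 * k1 ^+ 2 / w t ^+ 3).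
Proof.
move=> wt; have w0 := lt0r_neq0 wt.
have w20 : w t ^+ 2 != 0 by rewrite expf_neq0.
apply: (is_derive_eq (is_derive1_scale (2 * k * m%:R * k1)
  (@is_derive1_inv _ (fun s => w s ^+ 2) _ _ w20
     (is_derive1_pow 2 (is_derive_denominator t))))).
by rewrite /=; field.
Qed.

Lemma phi_sol_gt0 (t : R) : 0 < w t -> 0 < phi_sol n k1 k2 t.
Proof. by move=> wt; rewrite powR_gt0 // divr_gt0. Qed.

Lemma f_sol_gt0 (t : R) : 0 < w t -> 0 < f_sol n k k1 k2 t.
Proof. by move=> wt; rewrite divr_gt0 ?mulr_gt0. Qed.

Lemma is_derive1_comp_scale (F : R -> R) (F' : R -> R) (tau sigma t : R) :
  is_derive (sigma * t) 1 F (F' (sigma * t)) ->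
  is_derive t 1 (fun s => tau * F (sigma * s)) (tau * (F' (sigma * t) * sigma)).
Proof.
move=> dF; apply: is_derive1_scale; apply: is_derive1_chain => //.
by have := is_derive1_scale sigma (is_derive_id t 1); rewrite mulr1.
Qed.

(** The equations only contain phi through phi''/phi and phi'/phi, up to a
    factor phi, which disposes of [tau].  The reflection [sigma] multiplies
    first logarithmic derivatives by [sigma] and leaves second ones unchanged. *)
Lemma explicit_ricci_flat (eps alpha : 'I_n -> R) e (I : set R) (phi f : R -> R)
    sigma tau :
  (forall i, is_sign (eps i)) -> \sum_i eps i * alpha i ^+ 2 = e -> e != 0 ->
  open I -> is_sign sigma -> is_sign tau ->
  (forall t, I t -> half_line n k1 k2 (sigma * t)) ->
  (forall t, I t -> phi t = tau * phi_sol n k1 k2 (sigma * t) /\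
                    f t = f_sol n k k1 k2 (sigma * t)) ->
  warped_ricci_flat eps alpha I phi f.
Proof.
move=> heps halpha e0 oI ssigma stau Ihalf solE.
have Iw t : I t -> 0 < w (sigma * t) by move/Ihalf/half_lineP.
have phiE t (It : I t) := (solE t It).1.
(* The factor 1 puts f in the form handled by [is_derive1_comp_scale]. *)
have fE t : I t -> f t = 1 * f_sol n k k1 k2 (sigma * t).
  by move=> It; rewrite mul1r (solE t It).2.
have tau0 : tau != 0 by case: stau => ->; rewrite ?oppr_eq0 oner_eq0.
have sigma2 : sigma ^+ 2 = 1 by case: ssigma => ->; rewrite ?sqrrN expr1n.
have phi0 t : I t -> phi t != 0.
  by move=> It; rewrite phiE // mulf_neq0 ?(lt0r_neq0 (phi_sol_gt0 _ _)) ?Iw.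
have f0 t : I t -> f t != 0.
  by move=> It; rewrite fE // mul1r (lt0r_neq0 (f_sol_gt0 _ _)) ?Iw.
pose p1 t := tau * (2 * k1 / w (sigma * t) * phi_sol n k1 k2 (sigma * t) * sigma).
pose p2 t := tau * (2 * (m%:R + 2) * k1 ^+ 2 / w (sigma * t) ^+ 2
                    * phi_sol n k1 k2 (sigma * t) * sigma * sigma).
pose q1 t := 1 * (2 * k * m%:R * k1 / w (sigma * t) ^+ 2 * sigma).
pose q2 t := 1 * (4 * k * m%:R ^+ 2 * k1 ^+ 2 / w (sigma * t) ^+ 3 * sigma * sigma).
have dp t : I t -> is_derive t 1 phi (p1 t).
  move=> It; apply: (is_derive1_open _ oI It phiE).
  apply: (@is_derive1_comp_scale _ (fun s => 2 * k1 / w s * phi_sol n k1 k2 s)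
    tau sigma t).
  exact/is_derive_phi_sol/Iw.
have dp1 t : I t -> is_derive t 1 p1 (p2 t).
  move=> It; have -> : p1 = fun s =>
      tau * sigma * (2 * k1 / w (sigma * s) * phi_sol n k1 k2 (sigma * s)).
    by apply/funext => s; rewrite /p1; ring.
  apply: (is_derive_eq (@is_derive1_comp_scale _
    (fun s => 2 * (m%:R + 2) * k1 ^+ 2 / w s ^+ 2 * phi_sol n k1 k2 s)
    (tau * sigma) sigma t (is_derive_phi_sol' _ (Iw t It)))).
  by rewrite /p2; ring.
have dq t : I t -> is_derive t 1 f (q1 t).
  move=> It; apply: (is_derive1_open _ oI It fE).
  apply: (@is_derive1_comp_scale _ (fun s => 2 * k * m%:R * k1 / w s ^+ 2)
    1 sigma t).
  exact/is_derive_f_sol/Iw.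
have dq1 t : I t -> is_derive t 1 q1 (q2 t).
  move=> It; have -> : q1 = fun s =>
      1 * sigma * (2 * k * m%:R * k1 / w (sigma * s) ^+ 2).
    by apply/funext => s; rewrite /q1; ring.
  apply: (is_derive_eq (@is_derive1_comp_scale _
    (fun s => 4 * k * m%:R ^+ 2 * k1 ^+ 2 / w s ^+ 3)
    (1 * sigma) sigma t (is_derive_f_sol' _ (Iw t It)))).
  by rewrite /q2; ring.
have n1 : n != 1%N by [].
apply: (proj2 (warped_ricci_flat_odes _ _ heps halpha _ _ oI dp dp1 dq dq1
  phi0 f0 e0 n1)).
move=> t It; have w0 := lt0r_neq0 (Iw t It).
have p0 := lt0r_neq0 (phi_sol_gt0 _ (Iw t It)).
have k0 := lt0r_neq0 k_gt0.
rewrite /ricci_flat_odes phiE // fE // /p1 /p2 /q1 /q2 nE.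
rewrite /f_sol -/(denominator n k1 k2 (sigma * t)) -/w.
move: (phi_sol _ _ _ _) p0 (w _) w0 => p p0 v v0; rewrite addrK.
have p1E : tau * (2 * k1 / v * p * sigma) / (tau * p) = 2 * k1 * sigma / v.
  by field; rewrite p0 v0.
have p2E : tau * (2 * (m%:R + 2) * k1 ^+ 2 / v ^+ 2 * p * sigma * sigma) / (tau * p)
    = 2 * (m%:R + 2) * k1 ^+ 2 / v ^+ 2.
  transitivity (2 * (m%:R + 2) * k1 ^+ 2 / v ^+ 2 * sigma ^+ 2).
    by field; rewrite p0 v0.
  by rewrite sigma2 mulr1.
have q1E : 1 * (2 * k * m%:R * k1 / v ^+ 2 * sigma) / (1 * (2 * k / v)) =
    m%:R * k1 * sigma / v by field; rewrite k0 v0.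
have q2E : 1 * (4 * k * m%:R ^+ 2 * k1 ^+ 2 / v ^+ 3 * sigma * sigma) /
    (1 * (2 * k / v)) = 2 * m%:R ^+ 2 * k1 ^+ 2 / v ^+ 2.
  transitivity (2 * m%:R ^+ 2 * k1 ^+ 2 / v ^+ 2 * sigma ^+ 2).
    by field; rewrite k0 v0.
  by rewrite sigma2 mulr1.
rewrite p1E p2E q1E q2E; split; last by field.
- transitivity (4 * m%:R * k1 ^+ 2 / v ^+ 2 * (1 - sigma ^+ 2)); first by field.
  by rewrite sigma2 subrr mulr0.
- transitivity ((2 * m%:R + 4) * k1 ^+ 2 / v ^+ 2 * (1 - sigma ^+ 2)); first by field.
  by rewrite sigma2 subrr mulr0.
Qed.

(** The derivative of C (c t + d)^r has the same form, so the claim is proved for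
    all functions of this form at once by induction on the order. *)
Lemma smooth_affine_power (I : set R) (c d : R) : open I ->
  (forall t, I t -> 0 < c * t + d) ->
  forall h C r, (forall t, I t -> h t = C * (c * t + d) `^ r) -> smooth_on I h.
Proof.
move=> oI Ipos h C r hE j; elim: j h C r hE => [|j IHj] h C r hE t It.
all: have dh s (Is : I s) :
    is_derive s 1 h (C * r * c * (c * s + d) `^ (r - 1)).
(* The derivative formula, in the base case and in the induction step. *)
1,3: apply: (is_derive1_open _ oI Is hE);
  have := is_derive1_scale C (@is_derive1_chain _ (fun s => c * s + d) _ _ _ _
    (is_derive1_powR r (Ipos s Is)) (is_derive1_affine c d s));
  by move/is_derive_eq; apply; ring.
  by have [] := dh t It.
rewrite derive1Sn; apply: (IHj _ (C * r * c) (r - 1)) => // s Is.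
by rewrite derive1E; have [_ ->] := dh s Is.
Qed.

Let I := half_line n k1 k2.

Lemma open_half_line : open I. Proof. exact: open_lt. Qed.

Let I_pos t : I t -> 0 < (- n%:R + 2) * k1 * t + k2.
Proof. by move/half_lineP. Qed.

Lemma smooth_phi_sol : smooth_on I (phi_sol n k1 k2).
Proof.
apply: (@smooth_affine_power _ _ _ open_half_line I_pos _
  (2 `^ (2 / (n%:R - 2))) (- 1 * (2 / (n%:R - 2)))) => t /I_pos wt.
rewrite /phi_sol powRM ?invr_ge0 ?(ltW wt) //.
rewrite [X in _ = _ * X]powRrM powR_inv1 //.
exact: ltW.
Qed.

Lemma smooth_f_sol : smooth_on I (f_sol n k k1 k2).
Proof.
apply: (@smooth_affine_power _ _ _ open_half_line I_pos _ (2 * k) (- 1)) => t.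
by move/I_pos => wt; rewrite /f_sol powR_inv1 // ltW.
Qed.

Let w_onto (v : R) : 0 < v -> exists2 t, I t & (- n%:R + 2) * k1 * t + k2 = v.
Proof.
move=> v0; have E : w ((v - k2) / ((- n%:R + 2) * k1)) = v.
  rewrite /w /denominator mulrC divfK ?subrK // mulf_neq0 ?(lt0r_neq0 k1_gt0) //.
  by rewrite nE opprD addrNK oppr_eq0.
by exists ((v - k2) / ((- n%:R + 2) * k1)) => //; apply/half_lineP; rewrite E.
Qed.

Lemma nonconstant_phi_sol : nonconstant_on I (phi_sol n k1 k2).
Proof.
have [s Is ws] := w_onto _ ltr01; have [t It wt] := w_onto _ (ltr0n R 2).
exists s, t; split=> //; rewrite /phi_sol ws wt divr1 divff ?pnatr_eq0 // powR1.
have p0 : 2 / m%:R != 0 :> R by rewrite mulf_neq0 ?invr_eq0 ?pnatr_eq0 -?lt0n.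
by rewrite powR_eq1 !negb_or -leNgt nE addrK p0 ler0n pnatr_eq1.
Qed.

Lemma nonconstant_f_sol : nonconstant_on I (f_sol n k k1 k2).
Proof.
have [s Is ws] := w_onto _ ltr01; have [t It wt] := w_onto _ (ltr0n R 2).
exists s, t; split=> //; rewrite /f_sol ws wt divr1 mulrAC divff ?pnatr_eq0 //.
by apply/eqP => E; have := k_gt0; lra.
Qed.

End ExplicitSolutions.

(** * Classification *)

Section Main.
Set Implicit Arguments.
Context {R : realType}.

Lemma smooth_is_derive (I : set R) (h : R -> R) j : smooth_on I h ->
  forall t, I t -> is_derive t 1 (derive1n j h) (derive1n j.+1 h t).
Proof.
by move=> sh t It; rewrite derive1nS derive1E; apply: derivableP; exact: sh.
Qed.

(** The system is invariant under phi |-> tau phi, so [odes_solution] applies to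
    the positive function [tau * phi].  If 2 / (c - d t) comes out, then [sigma]
    is the sign of [d] and k1 = |d| / m, so that the slope of the denominator in
    [sigma * t] is negative. *)
Lemma classification (m : nat) (eps alpha : 'I_m.+2 -> R) e (I : set R)
    (phi f : R -> R) :
  (0 < m)%N -> (forall i, is_sign (eps i)) ->
  \sum_i eps i * alpha i ^+ 2 = e -> e != 0 ->
  open I -> is_interval I -> smooth_on I phi -> smooth_on I f ->
  nonconstant_on I phi -> nonconstant_on I f ->
  (forall t, I t -> phi t != 0) -> (forall t, I t -> 0 < f t) ->
  warped_ricci_flat eps alpha I phi f ->
  exists sigma tau k k1 k2 : R,
    [/\ is_sign sigma /\ is_sign tau, 0 < k, 0 < k1,
        forall t, I t -> half_line m.+2 k1 k2 (sigma * t) &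
        forall t, I t ->
          phi t = tau * phi_sol m.+2 k1 k2 (sigma * t) /\
          f t = f_sol m.+2 k k1 k2 (sigma * t)].
Proof.
move=> m0 heps halpha e0 oI itvI sphi sf nphi nf phi0 f0 flat.
have dphi := smooth_is_derive 0 sphi; have dphi1 := smooth_is_derive 1 sphi.
have df := smooth_is_derive 0 sf; have df1 := smooth_is_derive 1 sf.
have f_neq0 t : I t -> f t != 0 by move/f0/lt0r_neq0.
have n1 : m.+2 != 1%N by [].
have odes := proj1 (warped_ricci_flat_odes _ _ heps halpha _ _ oI
  dphi dphi1 df df1 phi0 f_neq0 e0 n1) flat.
have [tau [stau tau_phi]] := neq0_constant_sign _ itvI dphi phi0.
have tau0 : tau != 0 by case: stau => ->; rewrite ?oppr_eq0 oner_eq0.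
have tau2 : tau * tau = 1 by case: stau => ->; rewrite ?mulrNN mulr1.
have [k [d [c [k0 d0 sol]]]] : exists k d c, [/\ 0 < k, d != 0 &
  forall t, I t -> [/\ 0 < c - d * t, f t = k * (2 / (c - d * t)) &
                  tau * phi t = (2 / (c - d * t)) `^ (2 / m%:R)]].
  apply: (@odes_solution _ m I (fun t => tau * phi t)
    (fun t => tau * derive1n 1 phi t) (fun t => tau * derive1n 2 phi t)
    f (derive1n 1 f) (derive1n 2 f)) => //.
  - by move=> t It; exact/is_derive1_scale/dphi.
  - by move=> t It; exact/is_derive1_scale/dphi1.
  - have [s [t [Is It st]]] := nphi; exists s, t; split=> //.
    by rewrite (inj_eq (mulfI tau0)).
  - move=> t It; have [A B C] := odes t It.
    rewrite /ricci_flat_odes !(mulrC tau) -!mulf_div divff // !mulr1; split=> //.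
    by transitivity (tau * 0); [rewrite -C derive1n0; ring|rewrite mulr0].
have s_d : is_sign (Num.sg d) by case: sgrP d0 => // _ _; [left|right].
pose k1 := `|d| / m%:R.
have mR0 : m%:R != 0 :> R by rewrite pnatr_eq0 -lt0n.
have wE t : (- m.+2%:R + 2) * k1 * (Num.sg d * t) + c = c - d * t.
  rewrite -addn2 natrD opprD addrNK [in RHS](numEsg d) /k1.
  by field.
have k10 : 0 < k1 by rewrite divr_gt0 ?normr_gt0 ?ltr0n.
exists (Num.sg d), tau, k, k1, c; split=> //.
  by move=> t It; apply/half_lineP => //; rewrite /denominator wE; case: (sol t It).
move=> t It; have [_ -> tphi] := sol t It.
rewrite /phi_sol /f_sol !wE; split; last by rewrite mulrA (mulrC k).
by rewrite -[m.+2]addn2 natrD addrK -tphi mulrA tau2 mul1r.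
Qed.

End Main.

(* The metric is unchanged under phi |-> - phi, and (alpha, xi) may be replaced
   by (- alpha, - xi). The first clause is the classification with these two
   symmetries normalized (phi > 0, and domain unbounded in the direction of
   decreasing xi: R^n or a half space xi < c); the second one is
   the classification on an arbitrary slab, up to these symmetries; the third
   one says that the explicit solutions live on the stated half space. *)
Theorem theorem1p3 (R : realType) (n : nat) (hn : (3 <= n)%N)
    (eps alpha : 'I_n -> R) (heps : forall i, is_sign (eps i))
    (i0 : 'I_n) (halpha : \sum_i eps i * alpha i ^+ 2 = eps i0) :
  (forall (I : set R) (phi f : R -> R),
     open I -> is_interval I ->
     smooth_on I phi -> smooth_on I f ->
     nonconstant_on I phi -> nonconstant_on I f ->
     (forall t, I t -> phi t != 0) -> (forall t, I t -> 0 < f t) ->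
     ((forall t, I t -> 0 < phi t) -> ~ has_lbound I ->
        (warped_ricci_flat eps alpha I phi f <->
         exists k k1 k2 : R,
           [/\ 0 < k, 0 < k1, I `<=` half_line n k1 k2 &
               forall t, I t ->
                 phi t = phi_sol n k1 k2 t /\ f t = f_sol n k k1 k2 t]))
     /\
     (warped_ricci_flat eps alpha I phi f <->
      exists sigma tau k k1 k2 : R,
        [/\ is_sign sigma /\ is_sign tau, 0 < k, 0 < k1,
            forall t, I t -> half_line n k1 k2 (sigma * t) &
            forall t, I t ->
              phi t = tau * phi_sol n k1 k2 (sigma * t) /\
              f t = f_sol n k k1 k2 (sigma * t)]))
  /\
  (forall k k1 k2 : R, 0 < k -> 0 < k1 ->
     let I := half_line n k1 k2 in
     [/\ smooth_on I (phi_sol n k1 k2) /\ smooth_on I (f_sol n k k1 k2),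
         nonconstant_on I (phi_sol n k1 k2) /\
         nonconstant_on I (f_sol n k k1 k2),
         forall t, I t -> 0 < phi_sol n k1 k2 t /\ 0 < f_sol n k k1 k2 t &
         warped_ricci_flat eps alpha I (phi_sol n k1 k2) (f_sol n k k1 k2)]).
Proof.
case: n hn eps alpha heps i0 halpha => [|[|m]] // m0 eps alpha heps i0 halpha.
have e0 := sign_neq0 _ heps i0.
split=> [I phi f oI itvI sphi sf nphi nf phi0 f0|k k1 k2 k0 k10 I].
  have fwd := classification m0 heps halpha e0 oI itvI sphi sf nphi nf phi0 f0.
  split=> [phi_gt0 unb|]; split=> //.
  - move/fwd => [sigma [tau [k [k1 [k2 [[ssigma stau] k0 k10 Ihalf sol]]]]]].
    have [s0 [_ [Is0 _ _]]] := nphi.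
    (* The reflected solution lives on a half line bounded below. *)
    case: ssigma => sE; subst sigma; last first.
      exfalso; apply: unb; exists (- (k2 / ((m.+2%:R - 2) * k1))) => t /Ihalf.
      by rewrite /half_line /= mulN1r ltrNl => /ltW.
    (* At any point the sign of phi forces tau = 1. *)
    case: stau => tE; subst tau; last first.
      have := phi_gt0 _ Is0; rewrite (sol _ Is0).1 mulN1r oppr_gt0 ltNge.
      by rewrite powR_ge0.
    exists k, k1, k2; split=> // t It; first by rewrite -[t]mul1r; exact: Ihalf.
    by have := sol t It; rewrite !mul1r.
  - move=> [k [k1 [k2 [k0 k10 Ihalf sol]]]].
    apply: (@explicit_ricci_flat R m m0 k k1 k2 k0 k10 _ _ _ _ _ _ 1 1
              heps halpha e0 oI).
    + by left.
    + by left.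
    + by move=> t /Ihalf; rewrite mul1r.
    + by move=> t /sol; rewrite !mul1r.
  - move=> [sigma [tau [k [k1 [k2 [[ssigma stau] k0 k10 Ihalf sol]]]]]].
    exact: (explicit_ricci_flat m0 _ k0 k10 _ _ _ _ heps halpha e0 oI
              ssigma stau Ihalf sol).
have Ipos t : I t -> 0 < denominator m.+2 k1 k2 t by move/half_lineP; apply.
split.
- by split; [exact: smooth_phi_sol|exact: smooth_f_sol].
- by split; [exact: nonconstant_phi_sol|exact: nonconstant_f_sol].
- by move=> t /Ipos wt; split; [exact: phi_sol_gt0|exact: f_sol_gt0].
- apply: (@explicit_ricci_flat R m m0 k k1 k2 k0 k10 _ _ _ _ _ _ 1 1
            heps halpha e0).
  + exact: open_half_line.
  + by left.
  + by left.
  + by move=> t; rewrite mul1r.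
  + by move=> t; rewrite !mul1r.
Qed.
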